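(* In a knapsack budgeted game $(N,v)$ with representation $(\{(l_1,w_1),\ldots,(l_{|N|},w_{|N|})\}, l_{\mathrm{bin}})$, the Shapley value $\phi_i(v)$ of any given agent $i$ can be computed exactly in time $O\big(l_{\mathrm{bin}}(w_{\max}+1)^{l_{\mathrm{bin}}+1}|N|^2\big)$, where $w_{\max}=\lceil l_{\mathrm{bin}}\cdot \max_k w_k/l_k\rceil$.
   Context: A cooperative game $(N,v)$ consists of a finite set $N$ of agents and a function $v:2^N\to\mathbb R$ with $v(\emptyset)=0$. The Shapley value of agent $i$ is $\phi_i(v)=\sum_{S\subseteq N\setminus\{i\}}\frac{|S|!\,(|N|-|S|-1)!}{|N|!}\big(v(S\cup\{i\})-v(S)\big)$. A knapsack budgeted game is a cooperative game $(N,v)$, with agents labeled $1,\ldots,|N|$, given by nonnegative integers $(\{(l_1,w_1),\ldots,(l_{|N|},w_{|N|})\}, l_{\mathrm{bin}})$ with $0<l_i\le l_{\mathrm{bin}}$ for all $i$, such that $v(S)=\max_{S'\subseteq S:\ l(S')\le l_{\mathrm{bin}}} w(S')$ for all $S\subseteq N$, where $l(S')=\sum_{k\in S'}l_k$ and $w(S')=\sum_{k\in S'}w_k$. Running times count arithmetic operations at unit cost. *)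

(* Defs.v *)
From HB Require Import structures.
From mathcomp Require Import all_boot all_order all_algebra.
Set Implicit Arguments. Unset Strict Implicit. Unset Printing Implicit Defensive.
Import Order.TTheory GRing.Theory Num.Theory.

Definition game (n : nat) := {set 'I_n} -> rat.

Definition is_game (n : nat) (v : game n) : Prop := v set0 = 0%R.

Definition shapley (n : nat) (v : game n) (i : 'I_n) : rat :=
  (\sum_(S : {set 'I_n} | i \notin S)
     ((#|S|`! * (n - #|S| - 1)`!)%:R / (n`!)%:R) * (v (i |: S) - v S))%R.

Definition knapsack_value (n : nat) (l w : 'I_n -> nat) (lbin : nat)
    (S : {set 'I_n}) : nat :=
  \max_(S' : {set 'I_n} | (S' \subset S) && (\sum_(k in S') l k <= lbin))
     \sum_(k in S') w k.

Definition knapsack_game (n : nat) (l w : 'I_n -> nat) (lbin : nat) : game n :=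
  fun S => ((knapsack_value l w lbin S)%:R)%R.

(* w_max = ceil(lbin * max_k w_k / l_k) = max_k ceil(lbin * w_k / l_k)
   (ceil is monotone); for l_k > 0, ceil(a / b) = (a + b - 1) %/ b. *)
Definition knap_wmax (n : nat) (l w : 'I_n -> nat) (lbin : nat) : nat :=
  \max_(k < n) ((lbin * w k + l k - 1) %/ l k).

Definition knap_bound (n : nat) (l w : 'I_n -> nat) (lbin : nat) : nat :=
  lbin * (knap_wmax l w lbin).+1 ^ lbin.+1 * n ^ 2.

(* Model of computation: a unit-cost RAM over the rationals.          *)
(* Every executed instruction (in particular every arithmetic         *)
(* operation) costs one time unit.                                     *)

Inductive instr : Type :=
  | IConst of nat & rat
  | IAdd of nat & nat & nat
  | ISub of nat & nat & nat
  | IMul of nat & nat & nat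
  | IDiv of nat & nat & nat      (* r_d := r_a / r_b   (x / 0 = 0)    *)
  | ILoad of nat & nat
  | IStore of nat & nat
  | IJlt of nat & nat & nat
  | IJmp of nat
  | IHalt.

Definition program := seq instr.

Definition mstate := (nat * (nat -> rat))%type.

Definition mem_upd (m : nat -> rat) (r : nat) (x : rat) : nat -> rat :=
  fun j => if j == r then x else m j.

Definition addr (x : rat) : nat := `|Num.floor x|%N.

Definition halted (P : program) (s : mstate) : bool :=
  match nth IHalt P s.1 with IHalt => true | _ => false end.

Definition step (P : program) (s : mstate) : mstate :=
  let: (pc, m) := s in
  match nth IHalt P pc with
  | IConst d q => (pc.+1, mem_upd m d q)
  | IAdd d a b => (pc.+1, mem_upd m d (m a + m b)%R)
  | ISub d a b => (pc.+1, mem_upd m d (m a - m b)%R)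
  | IMul d a b => (pc.+1, mem_upd m d (m a * m b)%R)
  | IDiv d a b => (pc.+1, mem_upd m d (m a / m b)%R)
  | ILoad d a => (pc.+1, mem_upd m d (m (addr (m a))))
  | IStore a r => (pc.+1, mem_upd m (addr (m a)) (m r))
  | IJlt a b t => (if (m a < m b)%R then t else pc.+1, m)
  | IJmp t => (t, m)
  | IHalt => (pc, m)
  end.

Fixpoint run (P : program) (t : nat) (s : mstate) : option mstate :=
  if halted P s then Some s else
  match t with
  | 0 => None
  | t'.+1 => run P t' (step P s)
  end.

(* Input encoding of an instance (l, w, lbin) and queried agent i:
   r_0 = |N|, r_1 = l_bin, r_2 = label of i (agents labelled 1..|N|),
   r_(3+2k) = l_(k+1), r_(4+2k) = w_(k+1); all other registers 0.
   Program counter starts at 0. The output is read from r_0. *)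
Definition knap_input (n : nat) (l w : 'I_n -> nat) (lbin : nat) (i : 'I_n)
    : mstate :=
  (0%N, fun j =>
     if j == 0%N then (n%:R)%R
     else if j == 1%N then (lbin%:R)%R
     else if j == 2%N then ((i : nat).+1%:R)%R
     else let k := ((j - 3) %/ 2)%N in
       match insub k : option 'I_n with
       | Some k' => if odd (j - 3) then ((w k')%:R)%R else ((l k')%:R)%R
       | None => 0%R
       end).

(* Main.v *)
Require Import Defs.
From HB Require Import structures.
From mathcomp Require Import all_boot all_order all_algebra.
From mathcomp Require Import zify ring.
Set Implicit Arguments. Unset Strict Implicit. Unset Printing Implicit Defensive.
Import Order.TTheory GRing.Theory Num.Theory.

(* The marginal contribution of [i] to [A] depends only on the optimal values
   f_A(c) of the knapsack problem on [A] at all capacities c <= l_bin, and adding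
   an item to [A] changes this vector in a way that depends on the vector alone.
   With B = w_max + 1 every value is below B, so the pair (|A|, f_A) is coded
   by the integer |A| B^(l_bin+1) + sum_c f_A(c) B^c, one of n B^(l_bin+1).
   A table indexed by these codes starts as the weighted marginal contribution of
   [i] to a coalition in the given state. Processing an item k <> i adds to each
   entry the entry of the state obtained by adding k, so that after the items of a
   set K the entry of the state of [A] is the sum over S in K of the weighted
   contributions to A :|: S. Once all items are processed, the entry of the
   empty coalition is the Shapley value. Each of the n passes over the table
   costs O(l_bin) per entry.

   The machine has no rounding instruction, but addresses are rounded down: reading
   the identity table at base + x / B yields x %/ B, which extracts the digits. *)

(** * Structured programs and their running time *)

Inductive cmd : Type :=
  | Block of seq instr
  | Seq of cmd & cmd
  | While of nat & nat & cmd
  | If of nat & nat & cmd & cmd.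

Fixpoint csize (c : cmd) : nat :=
  match c with
  | Block b => size b
  | Seq c1 c2 => csize c1 + csize c2
  | While _ _ c => (csize c).+3
  | If _ _ c1 c2 => (csize c1 + csize c2).+2
  end.

(** Jump targets are absolute, hence the parameter [off], the address of the first instruction. The
    only test jumps when it succeeds, so the code of [If] puts the else branch first and the test
    jumps over it. *)
Fixpoint compile (off : nat) (c : cmd) : program :=
  match c with
  | Block b => b
  | Seq c1 c2 => compile off c1 ++ compile (off + csize c1) c2
  | While a b c =>
      [:: IJlt a b off.+2; IJmp (off + (csize c).+3)] ++
      (compile off.+2 c ++ [:: IJmp off])
  | If a b c1 c2 =>
      [:: IJlt a b (off + (csize c2).+2)] ++ (compile off.+1 c2 ++
      ([:: IJmp (off + (csize c1 + csize c2).+2)] ++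
       compile (off + (csize c2).+2) c1))
  end.

Lemma size_compile c off : size (compile off c) = csize c.
Proof.
elim: c off => [b|c1 IH1 c2 IH2|a b c IH|a b c1 IH1 c2 IH2] off //=;
  rewrite ?size_cat /= ?IH1 ?IH2 ?IH //; lia.
Qed.

Definition basic (i : instr) : bool :=
  match i with IJlt _ _ _ | IJmp _ | IHalt => false | _ => true end.

Definition bstep (m : nat -> rat) (i : instr) : nat -> rat :=
  (step [:: i] (0, m)).2.

Definition code_at (P : program) (off : nat) (p : program) : Prop :=
  forall j, j < size p -> nth IHalt P (off + j) = nth IHalt p j.

Lemma code_at_cat P off p q :
  code_at P off (p ++ q) -> code_at P off p /\ code_at P (off + size p) q.
Proof.
move=> h; split=> j hj.
  by rewrite h ?size_cat ?nth_cat ?hj //; lia.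
rewrite -addnA h ?size_cat ?nth_cat; last by lia.
by rewrite ifF; [congr nth; lia | lia].
Qed.

Lemma code_at_cons P off i p :
  code_at P off (i :: p) -> nth IHalt P off = i /\ code_at P off.+1 p.
Proof.
move=> h; split; first by have := h 0 isT; rewrite addn0.
by move=> j hj; rewrite addSnnS h.
Qed.

(** Quantifying over the remaining fuel makes execution segments composable, although [run] returns
    nothing before a halt. *)
Definition reaches (P : program) (t : nat) (s s' : mstate) : Prop :=
  forall t', run P (t + t') s = run P t' s'.

Lemma reaches_trans P t1 t2 s1 s2 s3 :
  reaches P t1 s1 s2 -> reaches P t2 s2 s3 -> reaches P (t1 + t2) s1 s3.
Proof. by move=> h1 h2 t'; rewrite -addnA h1 h2. Qed.

Lemma reaches_step P pc m :
  nth IHalt P pc <> IHalt -> reaches P 1 (pc, m) (step P (pc, m)).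
Proof.
move=> h t'; rewrite add1n [LHS]/=.
by have -> : halted P (pc, m) = false by rewrite /halted /=; case: (nth _ _ _) h.
Qed.

(* Started anywhere the code of [c] has been placed, from memory [m], execution
   falls through to the end of that code within [T] steps and in a memory
   satisfying [Q]. *)
Definition wp (c : cmd) (m : nat -> rat) (T : nat) (Q : (nat -> rat) -> Prop) :=
  forall P off, code_at P off (compile off c) ->
  exists t m', [/\ t <= T, reaches P t (off, m) (off + csize c, m') & Q m'].

Lemma wp_weaken c m T T' (Q Q' : (nat -> rat) -> Prop) :
  wp c m T Q -> T <= T' -> (forall m', Q m' -> Q' m') -> wp c m T' Q'.
Proof.
move=> h hT hQ P off hc; have [t [m' [h1 h2 h3]]] := h P off hc.
by exists t, m'; split=> //; [exact: leq_trans hT | exact: hQ].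
Qed.

Definition after (b : seq instr) (m : nat -> rat) (Q : (nat -> rat) -> Prop) :=
  Q (foldl bstep m b).

Lemma wp_block b m (Q : (nat -> rat) -> Prop) :
  all basic b -> after b m Q -> wp (Block b) m (size b) Q.
Proof.
move=> hb hQ P off /= hc; exists (size b), (foldl bstep m b); split=> // {hQ Q}.
elim: b off m hb hc => [|i b IH] off m /=.
  by rewrite addn0.
move=> /andP[hi hb] /code_at_cons[hn hc].
rewrite -add1n; apply: (@reaches_trans _ _ _ _ (off.+1, bstep m i)).
  have -> : (off.+1, bstep m i) = step P (off, m).
    by rewrite /bstep /= hn; case: i hi {hn}.
  by apply: reaches_step; rewrite hn; case: i hi {hn}.
by rewrite add1n -addSnnS; apply: IH.
Qed.

Lemma wp_seq c1 c2 m T1 T2 (Q : (nat -> rat) -> Prop) :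
  wp c1 m T1 (fun m1 => wp c2 m1 T2 Q) -> wp (Seq c1 c2) m (T1 + T2) Q.
Proof.
move=> h P off /= /code_at_cat[hc1]; rewrite size_compile => hc2.
have [t1 [m1 [ht1 r1 h2]]] := h P off hc1.
have [t2 [m2 [ht2 r2 hQ]]] := h2 P _ hc2.
exists (t1 + t2), m2; split=> //; first exact: leq_add.
by apply: reaches_trans r1 _; rewrite addnA.
Qed.

Lemma reaches_jlt P pc m a b t :
  nth IHalt P pc = IJlt a b t ->
  reaches P 1 (pc, m) (if (m a < m b)%R then t else pc.+1, m).
Proof.
move=> h; have -> : (if (m a < m b)%R then t else pc.+1, m) = step P (pc, m).
  by rewrite /= h.
by apply: reaches_step; rewrite h.
Qed.

Lemma reaches_jmp P pc m t :
  nth IHalt P pc = IJmp t -> reaches P 1 (pc, m) (t, m).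
Proof.
move=> h; have -> : (t, m) = step P (pc, m) by rewrite /= h.
by apply: reaches_step; rewrite h.
Qed.

Lemma wp_if a b c1 c2 m T (Q : (nat -> rat) -> Prop) :
  ((m a < m b)%R -> wp c1 m T Q) -> (~~ (m a < m b)%R -> wp c2 m T Q) ->
  wp (If a b c1 c2) m T.+2 Q.
Proof.
move=> h1 h2 P off /=; rewrite -/([:: _] ++ _).
move=> /code_at_cons[hj] /code_at_cat[hc2]; rewrite size_compile.
move=> /code_at_cons[hjmp hc1].
have e1 : (off.+1 + csize c2).+1 = off + (csize c2).+2 by lia.
rewrite e1 in hc1.
have r0 := reaches_jlt m hj.
case: ifPn r0 => hlt r0.
  have [t [m' [ht r hQ]]] := h1 hlt _ _ hc1.
  exists (1 + t), m'; split=> //; first by lia.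
  apply: reaches_trans r0 _.
  suff -> : off + (csize c1 + csize c2).+2 = off + (csize c2).+2 + csize c1 by [].
  by lia.
have [t [m' [ht r hQ]]] := h2 hlt _ _ hc2.
exists (1 + (t + 1)), m'; split=> //; first by lia.
by apply: reaches_trans r0 _; apply: reaches_trans r _; apply: reaches_jmp.
Qed.

(* [I f] holds when at most [f] iterations remain. *)
Lemma wp_while a b c m T F (I : nat -> (nat -> rat) -> Prop)
    (Q : (nat -> rat) -> Prop) :
  (forall f m', I f m' -> (m' a < m' b)%R ->
     exists2 f', f = f'.+1 & wp c m' T (I f')) ->
  (forall f m', I f m' -> ~~ (m' a < m' b)%R -> Q m') ->
  I F m -> wp (While a b c) m (F * T.+2 + 2) Q.
Proof.
move=> hbody hexit hI P off hc0; have hc := hc0; move: hc => /=.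
move=> /code_at_cons[hj] /code_at_cons[hx] /code_at_cat[hc].
rewrite size_compile => /code_at_cons[hb _].
elim: F m hI => [|F IH] m hI; have r0 := reaches_jlt m hj;
  case: ifPn r0 => hlt r0.
- by have [f' ? _] := hbody _ _ hI hlt.
- exists 2, m; split=> //; last exact: hexit hI hlt.
  by apply: (reaches_trans (t1 := 1) (t2 := 1)) r0 _; apply: reaches_jmp.
- have [f' [<-] hw] := hbody _ _ hI hlt.
  have [t [m1 [ht r hI1]]] := hw _ _ hc.
  have [t2 [m2 [ht2 r2 hQ]]] := IH _ hI1.
  exists (1 + (t + (1 + t2))), m2; split=> //; first by rewrite mulSn; lia.
  apply: reaches_trans r0 _; apply: reaches_trans r _.
  by apply: reaches_trans r2; apply: reaches_jmp.
- exists 2, m; split=> //.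
    by apply: (reaches_trans (t1 := 1) (t2 := 1)) r0 _; apply: reaches_jmp.
  exact: hexit hI hlt.
Qed.

Lemma wp_run c m T (Q : (nat -> rat) -> Prop) :
  wp c m T Q -> exists t s,
    [/\ t <= T, run (compile 0 c) t (0, m) = Some s & Q s.2].
Proof.
move=> /(_ (compile 0 c) 0)[|t [m' [ht r hQ]]]; first by [].
exists t, (csize c, m'); split=> //.
(* Past the end of the code [nth] returns its default [IHalt], so falling through the end is
   halting. *)
rewrite -[X in run _ X]addn0 r /= /halted nth_default //=.
by rewrite size_compile.
Qed.

(** * Knapsack states and the Shapley table *)

Lemma knapsack_value_set0 n (l w : 'I_n -> nat) c :
  knapsack_value l w c set0 = 0.
Proof.
apply/eqP; rewrite -leqn0; apply/bigop.bigmax_leqP => S /andP[].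
by rewrite subset0 => /eqP-> _; rewrite big_set0.
Qed.

(** This is the knapsack recursion: an optimal set either avoids [k], or removing [k] from it leaves
    a set that fits into the remaining capacity. *)
Lemma knapsack_value_setU1 n (l w : 'I_n -> nat) c k (A : {set 'I_n}) :
  k \notin A ->
  knapsack_value l w c (k |: A) =
    if c < l k then knapsack_value l w c A
    else maxn (knapsack_value l w c A) (knapsack_value l w (c - l k) A + w k).
Proof.
move=> kA; have sub_max c' (X S : {set 'I_n}) : S \subset X ->
    \sum_(j in S) l j <= c' -> \sum_(j in S) w j <= knapsack_value l w c' X.
  move=> h1 h2; rewrite /knapsack_value.
  by apply: (bigop.bigmax_sup S); rewrite ?h1 ?h2.
have mono : knapsack_value l w c A <= knapsack_value l w c (k |: A).
  apply/bigop.bigmax_leqP => S /andP[h1 h2]; apply: sub_max => //.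
  by apply: subset_trans h1 _; apply: subsetUr.
have split_k (S : {set 'I_n}) : S \subset k |: A -> k \in S -> S :\ k \subset A.
  by move=> hS hk; rewrite subDset.
case: ltnP => hc.
  apply/eqP; rewrite eqn_leq mono andbT.
  apply/bigop.bigmax_leqP => S /andP[h1 h2]; apply: sub_max => //.
  have hk : k \notin S.
    apply/negP => hk; move: h2; rewrite (big_setD1 k) //=; lia.
  apply/subsetP => j hj; move/subsetP: h1 => /(_ j hj).
  by rewrite in_setU1 => /predU1P[e|//]; rewrite e in hj; rewrite hj in hk.
apply/eqP; rewrite eqn_leq geq_max mono /=; apply/andP; split.
  apply/bigop.bigmax_leqP => S /andP[h1 h2]; rewrite leq_max.
  case: (boolP (k \in S)) => hk; last first.
    apply/orP; left; apply: sub_max => //.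
    apply/subsetP => j hj; move/subsetP: h1 => /(_ j hj).
    by rewrite in_setU1 => /predU1P[e|//]; rewrite e in hj; rewrite hj in hk.
  apply/orP; right; rewrite (big_setD1 k) //= addnC leq_add2r.
  apply: sub_max; first exact: split_k.
  by move: h2; rewrite (big_setD1 k) //=; lia.
(* The maximum is attained, because the empty set is feasible. *)
have [S /andP[h1 h2] ->] : {S : {set 'I_n} |
    (S \subset A) && (\sum_(j in S) l j <= c - l k) &
    knapsack_value l w (c - l k) A = \sum_(j in S) w j}.
  by apply: eq_bigmax_cond; apply/card_gt0P; exists set0;
    rewrite unfold_in sub0set big_set0.
have kS : k \notin S by apply: contra kA; apply/subsetP.
have -> : \sum_(j in S) w j + w k = \sum_(j in k |: S) w j.
  by rewrite big_setU1 //= addnC.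
apply: sub_max; first exact: setUS.
by rewrite big_setU1 //= -leq_subRL.
Qed.

(** No item has density above X / l_bin, so a total length of at most l_bin carries a value of at
    most X; everything is multiplied by l_bin to avoid division. *)
Lemma knapsack_value_le n (l w : 'I_n -> nat) lbin X c (A : {set 'I_n}) :
  (forall k, lbin * w k <= X * l k) -> 0 < lbin -> c <= lbin ->
  knapsack_value l w c A <= X.
Proof.
move=> hX l0 hc; apply/bigop.bigmax_leqP => S /andP[_ hS].
rewrite -(leq_pmul2l l0) big_distrr /=.
apply: (@leq_trans (\sum_(j in S) X * l j)); first exact: leq_sum.
by rewrite -big_distrr /= mulnC leq_mul2r (leq_trans hS hc) orbT.
Qed.

(** * Digits in base B *)

Section Digits.
Variable B : nat.
Hypothesis B0 : 0 < B.

Definition digit (x c : nat) : nat := (x %/ B ^ c) %% B.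

Lemma sum_digits_lt N (f : nat -> nat) :
  (forall c, c < N -> f c < B) -> \sum_(c < N) f c * B ^ c < B ^ N.
Proof.
clear B0; elim: N => [|N IH] h; first by rewrite big_ord0.
rewrite big_ord_recr /= expnS.
have h1 : \sum_(c < N) f c * B ^ c < B ^ N by apply: IH => c hc; apply: h; lia.
have h2 : f N < B by apply: h.
apply: (@leq_trans ((f N).+1 * B ^ N)); last by rewrite leq_mul2r h2 orbT.
by rewrite mulSn ltn_add2r.
Qed.

Lemma sum_digits_div N (f : nat -> nat) s :
  (forall c, c < N -> f c < B) -> (s * B ^ N + \sum_(c < N) f c * B ^ c) %/ B ^ N = s.
Proof.
move=> h; rewrite divnMDl ?expn_gt0 ?B0 // divn_small ?addn0 //.
exact: sum_digits_lt.
Qed.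

Lemma digit_sum N (f : nat -> nat) s c :
  (forall c, c < N -> f c < B) -> c < N ->
  digit (s * B ^ N + \sum_(c < N) f c * B ^ c) c = f c.
Proof.
elim: N s => // N IH s h hc; rewrite big_ord_recr /= ltnS in hc *.
(* The top digit is absorbed into the leading part, which becomes s B + f(N); the induction
   hypothesis holds for any leading part. *)
rewrite (addnC (\sum_(_ < _) _)) addnA expnS mulnA -mulnDl.
have h' c' : c' < N -> f c' < B by move=> ?; apply: h; lia.
move: hc; rewrite leq_eqVlt => /predU1P[-> | hc]; last exact: IH.
by rewrite /digit sum_digits_div // modnMDl modn_small // h.
Qed.

(* Gain at capacity [c] when an item of length [l] and value [w] is added to a
   set of items whose optimal values are the digits of [x]; the truncated
   subtraction takes the positive part. *)
Definition gain (l w x c : nat) : nat :=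
  if c < l then 0 else digit x (c - l) + w - digit x c.

Definition total_gain (l w x N : nat) : nat := \sum_(c < N) gain l w x c * B ^ c.

End Digits.

Definition weight (n s : nat) : rat := ((s`! * (n - s - 1)`!)%:R / (n`!)%:R)%R.

(** Together with [weightS] this is the recurrence by which the machine tabulates the Shapley
    weights at constant cost each, without factorials. *)
Lemma weight0 n : 0 < n -> weight n 0 = (1%:R / n%:R)%R.
Proof.
case: n => // n _; rewrite /weight subn0 subn1 /= factS fact0 mul1n natrM.
rewrite invfM mulrCA mulfV ?mulr1 ?mul1r // pnatr_eq0 -lt0n; exact: fact_gt0.
Qed.

Lemma weightS n s : s.+1 < n ->
  weight n s.+1 = (weight n s * s.+1%:R / (n - s.+1)%:R)%R.
Proof.
move=> hs; rewrite /weight.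
have [d hd] : exists d, n - s.+1 = d.+1 by exists (n - s.+1).-1; lia.
have -> : n - s - 1 = d.+1 by lia.
rewrite hd subn1 /= !factS !natrM.
have n0 : ((n`!)%:R != 0 :> rat)%R by rewrite pnatr_eq0 -lt0n fact_gt0.
have d0 : (d.+1%:R != 0 :> rat)%R by rewrite pnatr_eq0.
by field; rewrite n0 addrC natr1 d0.
Qed.

(** * Codes of coalitions and correctness of the table recursion *)

Section Shapley.
Variables (n : nat) (l w : 'I_n -> nat) (lbin X : nat) (i : 'I_n).
Hypothesis hl : forall k, 0 < l k <= lbin.
Hypothesis hX : forall k, lbin * w k <= X * l k.
Let B := X.+1.
Let N := lbin.+1.
Let V c A := knapsack_value l w c A.

Let lbin_gt0 : 0 < lbin.
Proof. by have /andP[] := hl i; exact: leq_trans. Qed.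

Definition state (A : {set 'I_n}) : nat :=
  #|A| * B ^ N + \sum_(c < N) V c A * B ^ c.

Lemma value_ltB A c : c < N -> V c A < B.
Proof. by move=> hc; rewrite ltnS; apply: knapsack_value_le hX lbin_gt0 _. Qed.

Lemma digit_state A c : c < N -> digit B (state A) c = V c A.
Proof.
move=> hc.
exact: (@digit_sum B isT N (fun c => V c A) #|A| c (fun c => @value_ltB A c)).
Qed.

Lemma state_div A : state A %/ B ^ N = #|A|.
Proof. exact: (@sum_digits_div B isT N (fun c => V c A) #|A| (fun c => @value_ltB A c)). Qed.

Lemma gain_state (A : {set 'I_n}) k c : k \notin A -> c < N ->
  V c A + gain B (l k) (w k) (state A) c = V c (k |: A).
Proof.
move=> kA hc; rewrite /gain /V knapsack_value_setU1 //.
case: ifP => h; first by rewrite addn0.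
rewrite !digit_state /V; lia.
Qed.

(** Adding an item acts on codes by an addition whose summand is computed from the code alone, so
    the table can be updated without knowing [A]. *)
Lemma state_setU1 (A : {set 'I_n}) k : k \notin A ->
  state A + B ^ N + total_gain B (l k) (w k) (state A) N = state (k |: A).
Proof.
move=> kA; rewrite {1 3}/state cardsU1 kA /total_gain mulSn.
under [X in _ = _ + X]eq_bigr => c _.
  rewrite -(@gain_state A k c kA (ltn_ord c)) mulnDl; over.
rewrite big_split /=; lia.
Qed.

(** A coalition without [i] has at most n - 1 members, so its code is an index of the table. *)
Lemma state_lt (A : {set 'I_n}) : i \notin A -> state A < n * B ^ N.
Proof.
move=> iA; have := @sum_digits_lt B N (fun c => V c A) (@value_ltB A).
have hA : #|A| < n.
  rewrite -[X in _ < X](card_ord n) -cardsT proper_card // properT.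
  by apply: contraNneq iA => ->; rewrite inE.
rewrite /state => hs; apply: (@leq_trans (#|A|.+1 * B ^ N)).
  by rewrite mulSn addnC ltn_add2r.
by rewrite leq_mul2r hA orbT.
Qed.

Lemma state_set0 : state set0 = 0.
Proof.
rewrite /state cards0 big1 // => c _; by rewrite /V knapsack_value_set0.
Qed.

Definition contribution (A : {set 'I_n}) : rat :=
  (weight n #|A| * (knapsack_game l w lbin (i |: A) - knapsack_game l w lbin A))%R.

Definition table0 (x : nat) : rat :=
  (weight n (x %/ B ^ N) * (gain B (l i) (w i) x lbin)%:R)%R.

(** Indices that code no coalition are updated as well, possibly from beyond the table; the final
    entry at 0 is built only from entries at codes of coalitions. *)
Definition table_step (k : 'I_n) (T : nat -> rat) (x : nat) : rat :=
  if x < n * B ^ N then (T x + T (x + B ^ N + total_gain B (l k) (w k) x N)%N)%R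
  else T x.

Lemma table0_state (A : {set 'I_n}) : i \notin A -> table0 (state A) = contribution A.
Proof.
move=> iA; rewrite /table0 state_div /contribution /knapsack_game.
congr (_ * _)%R; rewrite -/(V lbin (i |: A)) -/(V lbin A).
by rewrite -(gain_state iA (ltnSn _)) natrD addrC addKr.
Qed.

Definition below (k : nat) : {set 'I_n} := [set j : 'I_n | (j < k) && (j != i)].

(* [T k] is the table once the items [j < k], [j != i], have been processed. *)
Lemma table_state (T : nat -> nat -> rat) :
  (forall x, x < n * B ^ N -> T 0 x = table0 x) ->
  (forall (k : 'I_n) x, x < n * B ^ N ->
     T k.+1 x = if k == i then T k x else table_step k (T k) x) ->
  T n 0 = shapley (knapsack_game l w lbin) i.
Proof.
move=> h0 hS.
(* Restricting to coalitions of items not yet processed ensures that the next item is never already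
   in [A]. *)
have main k (A : {set 'I_n}) : k <= n -> i \notin A -> (forall j : 'I_n, j \in A -> k <= j) ->
    T k (state A) = (\sum_(S : {set 'I_n} | S \subset below k) contribution (A :|: S))%R.
  elim: k A => [|k IH] A hk iA hA.
    rewrite h0 ?table0_state ?state_lt // (big_pred1 set0) ?setU0 // => S.
    have -> : below 0 = set0 by apply/setP => j; rewrite !inE.
    by rewrite subset0.
  pose k' := Ordinal hk; rewrite (hS k') ?state_lt //.
  case: eqP => [e | /eqP ki].
    rewrite IH //; [ | lia | by move=> j /hA; lia].
    apply: eq_bigl => S; rewrite (_ : below k.+1 = below k) //; apply/setP => j; rewrite !inE.
    rewrite ltnS leq_eqVlt; case: (eqVneq j i) => [_|ji]; rewrite ?andbF // !andbT.
    suff -> : (j == k :> nat) = false by [].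
    by apply: contraNF ji => /eqP ejk; apply/eqP; rewrite -e; apply: val_inj.
  have kA : k' \notin A by apply/negP => /hA /=; lia.
  rewrite /table_step state_lt // state_setU1 //= !IH; try lia.
  (* The sets [S] without the new item give the old entry of [A]; those containing it give, after
     its removal, the old entry of [k' |: A]. *)
  - rewrite [in RHS](bigID (fun S : {set 'I_n} => k' \in S)) /= addrC; congr (_ + _)%R.
      apply: eq_bigl => S; apply/idP/andP => [h|[h kS]].
        split; first by apply: subset_trans h _; apply/subsetP => j; rewrite !inE; lia.
        by apply/negP => /(subsetP h); rewrite inE /= ltnn.
      apply/subsetP => j jS; move: (subsetP h j jS); rewrite !inE ltnS leq_eqVlt.
      case: eqP => [e|_] //=; case/negP: kS.
      by rewrite (_ : k' = j) //; apply: val_inj.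
    symmetry; rewrite (reindex_onto (fun S => k' |: S) (fun S => S :\ k')) /=; last first.
      by move=> S /andP[_ kS]; rewrite setD1K.
    apply: eq_big => S; last by move=> _; rewrite setUA (setUC A).
    apply/andP/idP => [[/andP[h _] /eqP e]|h]; last first.
      have kS : k' \notin S by apply/negP => /(subsetP h); rewrite inE /= ltnn.
      rewrite setU1K // setU11 eqxx andbT; split=> //.
      apply/subsetP => j; rewrite in_setU1 => /predU1P[->|/(subsetP h)].
        by rewrite inE /= ltnSn.
      by rewrite !inE; lia.
    apply/subsetP => j jS; have := subsetP h j; rewrite in_setU1 jS orbT => /(_ isT).
    rewrite !inE ltnS leq_eqVlt; case: eqP => [ejk|_] //=.
    by move: jS; rewrite -e !inE (_ : j = k') ?eqxx //; apply: val_inj.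
  - by rewrite in_setU1 negb_or eq_sym ki.
  - by move=> j; rewrite in_setU1 => /predU1P[->//|/hA]; lia.
  - by move=> j /hA; lia.
rewrite -[X in T n X]state_set0 main ?inE //; last by move=> j; rewrite inE.
rewrite /shapley; apply: eq_big => S.
  rewrite (_ : below n = ~: [set i]); last by apply/setP => j; rewrite !inE ltn_ord.
  by rewrite subsetC sub1set inE.
by move=> _; rewrite set0U.
Qed.

End Shapley.

(** * The program *)

Lemma addr_floor (u : rat) (a : nat) : (a%:R <= u < a.+1%:R)%R -> addr u = a.
Proof.
move=> h; rewrite /addr (@Num.Theory.floor_def _ u (Posz a)) //.
by rewrite (_ : (Posz a + 1)%R = Posz a.+1) // -addn1 PoszD.
Qed.

Lemma addr_nat (a : nat) : addr a%:R%R = a.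
Proof. by apply: addr_floor; rewrite lexx ltr_nat /=. Qed.

Lemma addr_divD (a x B : nat) : 0 < B ->
  addr (x%:R / B%:R + a%:R)%R = a + x %/ B.
Proof.
move=> B0; have B0' : (0 < B%:R :> rat)%R by rewrite ltr0n.
apply: addr_floor; rewrite -addnS !(natrD _ a) (addrC (_ / _)%R) lerD2l ltrD2l.
rewrite ler_pdivlMr // ltr_pdivrMr // -!natrM ler_nat ltr_nat leq_divM /=.
exact: ltn_ceil.
Qed.

Lemma upd_eq m r x : mem_upd m r x r = x.
Proof. by rewrite /mem_upd eqxx. Qed.

Lemma upd_eq' m r x j : j = r -> mem_upd m r x j = x.
Proof. by move->; apply: upd_eq. Qed.

Lemma upd_ne m r x j : j != r -> mem_upd m r x j = m j.
Proof. by rewrite /mem_upd => /negbTE->. Qed.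

(** * Symbolic execution of straight-line code *)

Section Steps.
Variables (m : nat -> rat) (rest : seq instr) (Q : (nat -> rat) -> Prop).
Implicit Types (d a b r x y p : nat) (u v : rat).

Lemma after_nil : Q m -> after [::] m Q.
Proof. by []. Qed.

Lemma after_const d u : after rest (mem_upd m d u) Q -> after (IConst d u :: rest) m Q.
Proof. by []. Qed.

Lemma after_add d a b u v : m a = u -> m b = v ->
  after rest (mem_upd m d (u + v)%R) Q -> after (IAdd d a b :: rest) m Q.
Proof. by move=> <- <-. Qed.

Lemma after_addn d a b x y : m a = x%:R%R -> m b = y%:R%R ->
  after rest (mem_upd m d (x + y)%:R%R) Q -> after (IAdd d a b :: rest) m Q.
Proof. by move=> ha hb; rewrite natrD; apply: after_add. Qed.

Lemma after_sub d a b u v : m a = u -> m b = v ->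
  after rest (mem_upd m d (u - v)%R) Q -> after (ISub d a b :: rest) m Q.
Proof. by move=> <- <-. Qed.

Lemma after_subn d a b x y : m a = x%:R%R -> m b = y%:R%R -> y <= x ->
  after rest (mem_upd m d (x - y)%:R%R) Q -> after (ISub d a b :: rest) m Q.
Proof. by move=> ha hb yx; rewrite natrB //; apply: after_sub. Qed.

Lemma after_mul d a b u v : m a = u -> m b = v ->
  after rest (mem_upd m d (u * v)%R) Q -> after (IMul d a b :: rest) m Q.
Proof. by move=> <- <-. Qed.

Lemma after_muln d a b x y : m a = x%:R%R -> m b = y%:R%R ->
  after rest (mem_upd m d (x * y)%:R%R) Q -> after (IMul d a b :: rest) m Q.
Proof. by move=> ha hb; rewrite natrM; apply: after_mul. Qed.

Lemma after_div d a b u v : m a = u -> m b = v ->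
  after rest (mem_upd m d (u / v)%R) Q -> after (IDiv d a b :: rest) m Q.
Proof. by move=> <- <-. Qed.

Lemma after_load_addr d a u p v : m a = u -> addr u = p -> m p = v ->
  after rest (mem_upd m d v) Q -> after (ILoad d a :: rest) m Q.
Proof. by move=> <- <- <-. Qed.

Lemma after_load d a p v : m a = p%:R%R -> m p = v ->
  after rest (mem_upd m d v) Q -> after (ILoad d a :: rest) m Q.
Proof. by move=> ha; apply: after_load_addr ha (addr_nat p). Qed.

Lemma after_store a r p v : m a = p%:R%R -> m r = v ->
  after rest (mem_upd m p v) Q -> after (IStore a r :: rest) m Q.
Proof.
move=> ha <-; rewrite -{1}(addr_nat p) -ha; exact: id.
Qed.

End Steps.

Lemma wp_le c m T T' Q : wp c m T Q -> T <= T' -> wp c m T' Q.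
Proof. by move=> h hT; apply: wp_weaken h hT _. Qed.

Lemma wp_if_eval a b c1 c2 m T Q u v : m a = u -> m b = v ->
  ((u < v)%R -> wp c1 m T Q) -> ((v <= u)%R -> wp c2 m T Q) ->
  wp (If a b c1 c2) m T.+2 Q.
Proof. by move=> <- <- h1 h2; apply: wp_if => //; rewrite -leNgt. Qed.

Definition agree (P : pred nat) (m m' : nat -> rat) : Prop :=
  forall r, P r -> m' r = m r.

Lemma agree_trans P m1 m2 m3 : agree P m1 m2 -> agree P m2 m3 -> agree P m1 m3.
Proof. by move=> h1 h2 r hr; rewrite h2 ?h1. Qed.

Lemma agree_sub (P P' : pred nat) m1 m2 :
  (forall r, P' r -> P r) -> agree P m1 m2 -> agree P' m1 m2.
Proof. by move=> h hP r /h; apply: hP. Qed.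

(** Fixed registers, item data, weights and identity table. Left out are the scratch registers 20 to
    31, the digit buffer from [D] to [Wb], and the main table from [Tb] on. *)
Definition env_region (D Wb Tb r : nat) : bool :=
  [|| r < 20, 32 <= r < D | Wb <= r < Tb].

Definition decode_region (D Wb r : nat) : bool :=
  [|| r < 22, 28 <= r < 30, 32 <= r < D | Wb <= r].

Ltac side := solve [ by [] | unfold env_region, decode_region in *; cbv beta; lia ].

(* Reads a register through the pending updates and the agreement hypotheses. *)
Ltac look :=
  lazymatch goal with
  | |- mem_upd ?m ?r ?x ?j = _ =>
     first [ constr_eq r j; refine (upd_eq m r x)
           | refine (eq_trans (@upd_ne m r x j _) _); [ side | look ]
           | refine (@upd_eq' m r x j _); side ]
  | |- _ =>
     first [ match goal with |- ?a = ?a => reflexivity end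
           | eassumption
           | match goal with
             | H : agree _ ?m0 ?m |- ?m ?r = _ =>
                 refine (eq_trans (H r _) _); [ side | solve [look | reflexivity] ]
             end ]
  end.

(** The natural-number rules are tried first, to keep contents in the form [x%:R] that addresses and
    comparisons rely on; a subtraction that may be negative falls back to the rationals. *)
Ltac one :=
  lazymatch goal with
  | |- after nil _ _ => refine (@after_nil _ _ _)
  | |- after (IConst _ _ :: _) _ _ => refine (@after_const _ _ _ _ _ _)
  | |- after (IAdd _ _ _ :: _) _ _ =>
      first [ eapply after_addn; [solve [look] | solve [look] | ]
            | eapply after_add; [solve [look] | solve [look] | ] ]
  | |- after (ISub _ _ _ :: _) _ _ =>
      first [ eapply after_subn; [solve [look] | solve [look] | side | ]
            | eapply after_sub; [solve [look] | solve [look] | ] ]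
  | |- after (IMul _ _ _ :: _) _ _ =>
      first [ eapply after_muln; [solve [look] | solve [look] | ]
            | eapply after_mul; [solve [look] | solve [look] | ] ]
  | |- after (IDiv _ _ _ :: _) _ _ =>
      eapply after_div; [solve [look] | solve [look] | ]
  | |- after (IStore _ _ :: _) _ _ =>
      eapply after_store; [solve [look] | solve [look] | ]
  | |- after (ILoad _ _ :: _) _ _ =>
      eapply after_load; [solve [look] | solve [look] | ]
  end.

Ltac blk := apply: wp_block; [by [] | repeat one].
Ltac agr := let r := fresh "r" in let h := fresh "hr" in
  intros r h; cbv beta in h; look.

Local Notation nat_at m r x := (m r = (x : nat)%:R%R :> rat).

Definition load_item :=
  Block [:: IAdd 30 10 20; IAdd 30 30 20; ILoad 28 30; IAdd 30 30 8; ILoad 29 30].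

Lemma load_item_correct m L k lk wk : nat_at m 8 1 -> nat_at m 10 L ->
  nat_at m 20 k -> nat_at m (L + k + k) lk -> nat_at m (L + k + k).+1 wk -> 30 < L ->
  wp load_item m 5 (fun m' =>
    [/\ agree (fun r => (r < 28) || (30 < r)) m m', nat_at m' 28 lk & nat_at m' 29 wk]).
Proof.
move=> h8 h10 hk hlk hwk L30; rewrite -addn1 in hwk.
by blk; split; [agr | look | look].
Qed.

(* Registers: 1 = l_bin, 3 = i + 1 (label of the agent), 7 = 0, 8 = 1, 9 = n,
   12 = B, 13 = M = B^(l_bin+1), 17 = n M, 18 = l_bin + 1; 10, 11, 14, 15, 16 hold
   the base addresses of the items, of the digits of the current code, of the
   coalition weights, of the identity table and of the main table. Scratch: 20 =
   item or size, 21 = code x, 22 = capacity c, 23 = x %/ B^c, 24 = digit, 25 = gain,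
   26 = accumulated change of the code, 27 = B^c, 28 and 29 = length and value of
   the current item. *)
Section Machine.
Variables (n : nat) (l w : 'I_n -> nat) (lbin X : nat) (i : 'I_n).
Hypothesis hl : forall k, 0 < l k <= lbin.

Notation B := X.+1.
Notation N := lbin.+1.
Notation M := (B ^ N).

(** Consecutive regions: 2 n cells of item data, N digits, n weights, n M cells of the identity
    table, then the main table. The items start at 8 n + 35 because the input items, which start at
    3, are moved up by 8 n + 32. *)
Variables (L D Wb Ib Tb : nat).
Hypothesis LE : L = 8 * n + 35.
Hypothesis DE : D = 10 * n + 35.
Hypothesis WbE : Wb = D + N.
Hypothesis IbE : Ib = Wb + n.
Hypothesis TbE : Tb = Ib + n * M.

(** Peels off the lowest remaining digit as a remainder and stores it, because the gain at capacity
    c also needs the digit at c - l, which is in the buffer by then. The inner test takes the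
    positive part of the gain. *)
Definition decode_step :=
  Seq (Block [:: IDiv 30 23 12; IAdd 30 30 15; ILoad 30 30; IMul 31 30 12;
                 ISub 24 23 31; IAdd 23 7 30; IAdd 30 11 22; IStore 30 24;
                 IConst 25 0%:R])
  (Seq (If 22 28 (Block [::])
     (Seq (Block [:: ISub 30 30 28; ILoad 30 30; IAdd 30 30 29; ISub 30 30 24])
          (If 7 30 (Block [:: IAdd 25 7 30]) (Block [::]))))
     (Block [:: IMul 30 25 27; IAdd 26 26 30; IMul 27 27 12; IAdd 22 22 8])).

Definition decode :=
  Seq (Block [:: IConst 22 0%:R; IAdd 23 7 21; IConst 26 0%:R; IConst 27 1%:R; IConst 25 0%:R])
      (While 22 18 decode_step).

Record env (m : nat -> rat) : Prop := Env {
  env1 : nat_at m 1 lbin;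
  env3 : nat_at m 3 i.+1;
  env7 : nat_at m 7 0;
  env8 : nat_at m 8 1;
  env9 : nat_at m 9 n;
  env10 : nat_at m 10 L;
  env11 : nat_at m 11 D;
  env12 : nat_at m 12 B;
  env13 : nat_at m 13 M;
  env14 : nat_at m 14 Wb;
  env15 : nat_at m 15 Ib;
  env16 : nat_at m 16 Tb;
  env17 : nat_at m 17 (n * M);
  env18 : nat_at m 18 N;
  env_l : forall k : 'I_n, nat_at m (L + k + k) (l k);
  env_w : forall k : 'I_n, nat_at m (L + k + k).+1 (w k);
  env_weight : forall s, s < n -> m (Wb + s) = weight n s;
  env_id : forall x, x < n * M -> nat_at m (Ib + x) x }.

Notation env_dom := (env_region D Wb Tb).

Lemma env_agree m m' : agree env_dom m m' -> env m -> env m'.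
Proof.
move=> ag e; split; try by rewrite ag; [case: e | rewrite /env_region; lia].
- by move=> k; rewrite ag; [apply: env_l | rewrite /env_region; have := ltn_ord k; lia].
- by move=> k; rewrite ag; [apply: env_w | rewrite /env_region; have := ltn_ord k; lia].
- by move=> s hs; rewrite ag; [apply: env_weight | rewrite /env_region; lia].
- by move=> x hx; rewrite ag; [apply: env_id | rewrite /env_region; lia].
Qed.

Notation decode_dom := (decode_region D Wb).

Lemma decode_spec m x lk wk : env m ->
  nat_at m 21 x -> nat_at m 28 lk -> nat_at m 29 wk -> x < n * M ->
  wp decode m (40 * N) (fun m' =>
    [/\ agree decode_dom m m', nat_at m' 23 (x %/ M),
        nat_at m' 25 (gain B lk wk x lbin) &
        nat_at m' 26 (total_gain B lk wk x N)]).
Proof.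
move=> em hx hlk hwk xM; have [] := em => *.
eapply wp_le.
apply: wp_seq.
blk.
(* Register 25 keeps the gain at the last capacity treated; as N = l_bin + 1, at the exit this is
   the gain at l_bin. *)
apply: (@wp_while _ _ _ _ 26 N (fun f m' => exists2 c, f + c = N &
   [/\ agree decode_dom m m', nat_at m' 22 c, nat_at m' 23 (x %/ B ^ c),
      nat_at m' 25 (if c is c'.+1 then gain B lk wk x c' else 0) &
     [/\ nat_at m' 26 (total_gain B lk wk x c), nat_at m' 27 (B ^ c) &
      forall c', c' < c -> nat_at m' (D + c') (digit B x c')]])).
- move=> f m1 [c fc [ag h22 h23 h25 [h26 h27 hd]]].
  have h18 : nat_at m1 18 N by look.
  rewrite h22 h18 ltr_nat => cN.
  exists f.-1; first by lia.
  have [q qE] : exists q, q = x %/ B ^ c.+1 by exists (x %/ B ^ c.+1).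
  have wb_dom j : decode_dom (Ib + j) by rewrite /decode_region; lia.
  have hB : addr ((x %/ B ^ c)%:R / B%:R + Ib%:R)%R = Ib + q.
    by rewrite addr_divD // -divnMA -expnSr qE.
  (* The quotient is at most x, so it lies within the identity table. *)
  have hId : nat_at m1 (Ib + q) q.
    have hq : q < n * M by apply: leq_ltn_trans xM; rewrite qE leq_div.
    by rewrite ag ?(env_id em) //; apply: wb_dom.
  have hdiv : q * B <= x %/ B ^ c by rewrite qE expnSr divnMA leq_divM.
  have hdig : x %/ B ^ c - q * B = digit B x c.
    by rewrite qE expnSr divnMA {1}(divn_eq (x %/ B ^ c) B) addKn.
  (* The three cases, item too long, positive gain and no gain, share this final block. *)
  have fin m2 : agree (fun r => [&& (r < 23) || (25 < r), r != 30, r != 31 & r != D + c]) m1 m2 ->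
      nat_at m2 23 q -> nat_at m2 (D + c) (digit B x c) ->
      nat_at m2 25 (gain B lk wk x c) ->
      wp (Block [:: IMul 30 25 27; IAdd 26 26 30; IMul 27 27 12; IAdd 22 22 8]) m2 4
       (fun m' => exists2 c0, f.-1 + c0 = N &
         [/\ agree decode_dom m m', nat_at m' 22 c0, nat_at m' 23 (x %/ B ^ c0),
          nat_at m' 25 (if c0 is c'.+1 then gain B lk wk x c' else 0) &
         [/\ nat_at m' 26 (total_gain B lk wk x c0), nat_at m' 27 (B ^ c0) &
          forall c', c' < c0 -> nat_at m' (D + c') (digit B x c')]]).
    move=> ag2 k23 kD k25; blk.
    exists c.+1; first by lia.
    split; [ | rewrite -[c.+1]addn1; look | rewrite -qE; look | look | split].
    - agr.
    - by rewrite /total_gain big_ord_recr; look.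
    - by rewrite expnSr; look.
    - move=> c'; rewrite ltnS leq_eqVlt => /predU1P[->|hc]; first by look.
      by have hdc := hd _ hc; look.
  rewrite /decode_step.
  apply: (@wp_le _ _ (9 + (7.+2 + 4))); last by [].
  apply: wp_seq; apply: wp_block; first by [].
  do 2 one.
  eapply after_load_addr; [look | exact: hB | look |].
  repeat one; rewrite hdig.
  apply: wp_seq; eapply wp_if_eval; [look | look | |]; rewrite ?ltr_nat ?ler_nat => hc.
    apply: (@wp_le _ _ 0) => //; apply: wp_block; first by [].
    one; apply: fin; [agr | look | look |].
    by rewrite /gain hc; look.
  apply: (@wp_le _ _ (4 + 1.+2)) => //; apply: wp_seq; apply: wp_block; first by [].
  one; eapply after_load; [look | |].
    rewrite -(addnBA D hc).
    have hlt : c - lk < c \/ c - lk = c by lia.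
    instantiate (1 := ((digit B x (c - lk))%:R)%R).
    case: hlt => hlt; first by have hd' := hd _ hlt; look.
    by rewrite hlt; look.
  repeat one.
  eapply wp_if_eval; [look | look | |];
    rewrite ?subr_gt0 ?subr_le0 ?ltr_nat ?ler_nat => hg.
    apply: wp_block; first by [].
    repeat one; apply: fin; [agr | look | look |].
    have -> : ((gain B lk wk x c)%:R = 0%:R +
        ((digit B x (c - lk) + wk)%:R - (digit B x c)%:R) :> rat)%R.
      by rewrite add0r -natrB ?(ltnW hg) // /gain ltnNge hc.
    by look.
  apply: (@wp_le _ _ 0) => //; apply: wp_block; first by [].
  one; apply: fin; [agr | look | look |].
  have -> : gain B lk wk x c = 0.
    by apply/eqP; rewrite /gain ltnNge hc subn_eq0.
  by look.
- move=> f m1 [c fc [ag h22 h23 h25 [h26 _ _]]].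
  have h18 : nat_at m1 18 N by look.
  rewrite h22 h18 ltr_nat -leqNgt => Nc.
  have e : c = N by lia.
  by rewrite e in h23 h25 h26.
- exists 0; first by rewrite addn0.
  split; [agr | look | rewrite expn0 divn1; look | look | split].
  - by rewrite /total_gain big_ord0; look.
  - by look.
  - by [].
- by rewrite /=; lia.
Qed.

Lemma load_item_spec m (k : 'I_n) : env m -> nat_at m 20 k ->
  wp load_item m 5 (fun m' =>
    [/\ agree (fun r => (r < 28) || (30 < r)) m m', nat_at m' 28 (l k) &
        nat_at m' 29 (w k)]).
Proof.
move=> em hk; apply: (load_item_correct (env8 em) (env10 em) hk (env_l em k) (env_w em k)).
lia.
Qed.

Notation table_at m T := (forall y, m (Tb + y) = T y).

(* In increasing order of [x] the update can be done in place, since the entry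
   that is added lies at least [M] further. *)
Definition pass_step :=
  Seq decode (Block [:: IAdd 30 16 21; ILoad 31 30; IAdd 24 30 13; IAdd 24 24 26;
                        ILoad 24 24; IAdd 31 31 24; IStore 30 31; IAdd 21 21 8]).

Definition pass := Seq (Block [:: IConst 21 0%:R]) (While 21 17 pass_step).

Notation tstep := (table_step l w lbin X).

Lemma pass_spec m T (k : 'I_n) : env m -> table_at m T ->
  nat_at m 28 (l k) -> nat_at m 29 (w k) ->
  wp pass m (60 * N * (n * M)) (fun m' =>
    agree (fun r => [|| r < 21, 32 <= r < D | Wb <= r < Tb]) m m' /\
    table_at m' (tstep k T)).
Proof.
move=> em hT h28 h29; have [] := em => *.
have nM : 0 < n * M by rewrite muln_gt0 expn_gt0 andbT; apply: leq_ltn_trans (ltn_ord k).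
apply: (@wp_le _ _ (1 + (n * M * (40 * N + 8).+2 + 2))); last by nia.
apply: wp_seq; blk.
apply: (@wp_while _ _ _ _ _ _ (fun f m' => exists2 x, f + x = n * M &
   [/\ agree (fun r => [|| r < 21, 28 <= r < 30, 32 <= r < D | Wb <= r < Tb]) m m',
      nat_at m' 21 x & table_at m' (fun y => if y < x then tstep k T y else T y)])).
- move=> f m1 [x fx [ag h21 ht]].
  have em1 : env m1 by apply: env_agree em; apply: agree_sub ag => r; side.
  have h17 := env17 em1.
  rewrite h21 h17 ltr_nat => xM; exists f.-1; first by lia.
  have h28' : nat_at m1 28 (l k) by look.
  have h29' : nat_at m1 29 (w k) by look.
  apply: wp_seq; apply: wp_weaken (decode_spec em1 h21 h28' h29' xM) _ _ => //.
  move=> m2 [ag2 _ _ h26].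
  have htx := ht x; rewrite ltnn in htx.
  have htt := ht (x + (M + total_gain B (l k) (w k) x N)).
  rewrite ltnNge leq_addr /= addnA addnA in htt.
  have [] := em1 => *.
  blk.
  exists x.+1; first by lia.
  split; [agr | by rewrite -[x.+1]addn1; look | move=> y].
  have hty := ht y; case: (ltngtP y x) hty => hyx hty.
  - by rewrite ltnS ltnW //; look.
  - by rewrite ltnS leqNgt hyx; look.
  - by rewrite hyx ltnSn /table_step xM addnA; look.
- move=> f m1 [x fx [ag h21 ht]].
  have h17 : nat_at m1 17 (n * M) by look.
  rewrite h21 h17 ltr_nat -leqNgt => Mx.
  split; first by apply: agree_sub ag => r; side.
  move=> y; rewrite ht; case: ifP => // hy.
  by rewrite /table_step ifF //; lia.
- exists 0; first by rewrite addn0.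
  split; [agr | look | move=> y].
  by have hty := hT y; look.
Qed.

(** * Filling the initial table *)

Definition init_step :=
  Seq decode (Block [:: IAdd 30 14 23; ILoad 30 30; IMul 30 30 25; IAdd 31 16 21;
                        IStore 31 30; IAdd 21 21 8]).

Definition init :=
  Seq (Block [:: ISub 20 3 8]) (Seq load_item
  (Seq (Block [:: IConst 21 0%:R]) (While 21 17 init_step))).

Lemma init_spec m : env m ->
  wp init m (60 * N * (n * M)) (fun m' =>
    agree env_dom m m' /\
    (forall x, x < n * M -> m' (Tb + x) = table0 l w lbin X i x)).
Proof.
move=> em; have [] := em => *.
have nM : 0 < n * M by rewrite muln_gt0 expn_gt0 andbT; apply: leq_ltn_trans (ltn_ord i).
apply: (@wp_le _ _ (1 + (5 + (1 + (n * M * (40 * N + 6).+2 + 2))))); last by nia.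
apply: wp_seq; blk.
apply: wp_seq; apply: (wp_weaken (load_item_spec (k := i) _ _)) => //.
- by apply: env_agree em; agr.
- by rewrite -[X in nat_at _ _ X](addnK 1) addn1; look.
move=> m0 [ag0 h28 h29].
have ag : agree env_dom m m0 by agr.
have em0 := env_agree ag em.
have [] := em0 => *.
apply: wp_seq; blk.
apply: (@wp_while _ _ _ _ _ _ (fun f m' => exists2 x, f + x = n * M &
   [/\ agree (fun r => [|| r < 20, 28 <= r < 30, 32 <= r < D | Wb <= r < Tb]) m0 m',
      nat_at m' 21 x & forall y, y < x -> m' (Tb + y) = table0 l w lbin X i y])).
- move=> f m1 [x fx [ag1 h21 ht]].
  have em1 : env m1 by apply: env_agree em0; apply: agree_sub ag1 => r; side.
  have h17 := env17 em1.
  rewrite h21 h17 ltr_nat => xM; exists f.-1; first by lia.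
  have h28' : nat_at m1 28 (l i) by look.
  have h29' : nat_at m1 29 (w i) by look.
  apply: wp_seq; apply: wp_weaken (decode_spec em1 h21 h28' h29' xM) _ _ => //.
  move=> m2 [ag2 h23 h25 _].
  have [s sE] : exists s, s = x %/ M by exists (x %/ M).
  rewrite -sE in h23.
  have hs := env_weight em1 (s := s).
  have {hs} hs : m1 (Wb + s) = weight n s.
    by apply: hs; rewrite sE ltn_divLR ?expn_gt0.
  have [] := em1 => *.
  blk.
  exists x.+1; first by lia.
  split; [agr | by rewrite -[x.+1]addn1; look | move=> y].
  rewrite ltnS leq_eqVlt => /predU1P[-> | hy].
    by rewrite /table0 -sE; look.
  by have hty := ht y hy; look.
- move=> f m1 [x fx [ag1 h21 ht]].
  have h17 : nat_at m1 17 (n * M) by look.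
  rewrite h21 h17 ltr_nat -leqNgt => Mx.
  split; first by apply: agree_trans ag _; apply: agree_sub ag1 => r; side.
  by move=> y hy; apply: ht; apply: leq_trans Mx.
- exists 0; first by rewrite addn0.
  by split; [agr | look | move=> y].
Qed.

(** With only a strict comparison at hand, k != i is tested as 0 < (k - i)^2, where k + 1 is
    compared with the label i + 1. *)
Definition solve_step :=
  Seq load_item (Seq (Block [:: IAdd 30 20 8; ISub 30 30 3; IMul 30 30 30])
    (Seq (If 7 30 pass (Block [::])) (Block [:: IAdd 20 20 8]))).

Definition solve :=
  Seq init (Seq (Block [:: IConst 20 0%:R])
    (Seq (While 20 9 solve_step) (Block [:: ILoad 0 16]))).

Fixpoint tables (T : nat -> rat) (k : nat) : nat -> rat :=
  if k is k'.+1 then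
    if insub k' is Some j then
      if j == i then tables T k' else tstep j (tables T k')
    else T
  else T.

Lemma solve_spec m : (forall k, lbin * w k <= X * l k) -> env m ->
  wp solve m (200 * N * M * n ^ 2)
     (fun m' => m' 0 = shapley (knapsack_game l w lbin) i).
Proof.
move=> hX em.
have n0 : 0 < n by apply: leq_ltn_trans (ltn_ord i).
have M0 : 0 < M by rewrite expn_gt0.
apply: (@wp_le _ _ (60 * N * (n * M) +
    (1 + ((n * (5 + (3 + ((60 * N * (n * M)).+2 + 1))).+2 + 2) + 1)))); last first.
  rewrite -mulnn; nia.
apply: wp_seq; apply: wp_weaken (init_spec em) _ _ => // m0 [ag0 hT0].
have em0 := env_agree ag0 em.
(* The starting table is the whole memory from [Tb] on, so reads beyond its n M initialized entries
   are covered too. *)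
pose T := tables (fun y => m0 (Tb + y)).
have := em0 => -[] *.
apply: wp_seq; blk.
apply: wp_seq.
apply: (@wp_while _ _ _ _ _ _ (fun f m' => exists2 k, f + k = n &
   [/\ agree env_dom m0 m', nat_at m' 20 k & table_at m' (T k)])).
- move=> f m1 [k fk [ag1 h20 ht]].
  have em1 := env_agree ag1 em0.
  have h9 := env9 em1.
  rewrite h20 h9 ltr_nat => kn; exists f.-1; first by lia.
  pose j := Ordinal kn.
  apply: wp_seq; apply: wp_weaken (load_item_spec (k := j) em1 h20) _ _ => //.
  move=> m2 [ag2 h28 h29].
  have [] := em1 => *.
  apply: wp_seq; blk.
  apply: wp_seq.
  have fin m3 : agree env_dom m1 m3 -> nat_at m3 20 k -> table_at m3 (T k.+1) ->
      wp (Block [:: IAdd 20 20 8]) m3 1 (fun m' => exists2 k, f.-1 + k = n &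
        [/\ agree env_dom m0 m', nat_at m' 20 k & table_at m' (T k)]).
    move=> ag3 h3 ht3.
    have h38 : nat_at m3 8 1 by look.
    blk; exists k.+1; first by lia.
    split; [agr | by rewrite -[k.+1]addn1; look | move=> y].
    by have hty := ht3 y; look.
  have TS : T k.+1 = if j == i then T k else tstep j (T k).
    by rewrite /T /= insubT.
  eapply wp_if_eval; [look | look | |]; rewrite -expr2 => hsq.
    have ji : j != i.
      by apply: contraTneq hsq => e; rewrite -e /= addn1 subrr expr0n.
    rewrite (negPf ji) in TS.
    apply: wp_weaken (pass_spec (T := T k) (k := j) _ _ _ _) _ _ => //; last first.
    - move=> m3 [ag3 ht3]; apply: fin; [agr | look | by rewrite TS].
    - by move=> y; have hty := ht y; look.
    - by apply: env_agree em1; agr.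
  have ji : j == i.
    move: hsq; rewrite real_exprn_even_le0 ?num_real //= subr_eq0 eqr_nat addn1 eqSS.
    by move=> /eqP e; apply/eqP/val_inj.
  rewrite ji in TS.
  apply: (@wp_le _ _ 0) => //; apply: wp_block; first by [].
  one; apply: fin; [agr | look | move=> y].
  by rewrite TS; have hty := ht y; look.
- move=> f m1 [k fk [ag1 h20 ht]].
  have h9 : nat_at m1 9 n by look.
  have h16 : nat_at m1 16 Tb by look.
  rewrite h20 h9 ltr_nat -leqNgt => nk.
  have {nk fk} e : k = n by lia.
  rewrite e in ht; have ht0 := ht 0; rewrite addn0 in ht0.
  blk; rewrite upd_eq.
  apply: (table_state hl hX); first exact: hT0.
  by move=> k' x _; rewrite /T /= valK; case: ifP.
- exists 0; first by rewrite addn0.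
  split; [agr | look | move=> y].
  by rewrite -[T 0 y]/(m0 (Tb + y)); look.
Qed.

(** * Setting up the constants, the weights and the identity table *)

Definition mk_env :=
  Seq (Block [:: IConst 13 1%:R; IConst 22 0%:R])
  (Seq (While 22 18 (Block [:: IMul 13 13 12; IAdd 22 22 8]))
  (Seq (Block [:: IAdd 14 11 18; IAdd 15 14 9; IMul 17 9 13; IAdd 16 15 17;
                  IDiv 25 8 9; IConst 20 0%:R])
  (Seq (While 20 9 (Block [:: IAdd 30 14 20; IStore 30 25; IAdd 20 20 8;
                              IMul 25 25 20; ISub 31 9 20; IDiv 25 25 31]))
  (Seq (Block [:: IConst 21 0%:R])
       (While 21 17 (Block [:: IAdd 30 15 21; IStore 30 21; IAdd 21 21 8])))))).

Lemma mk_env_spec m :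
  nat_at m 1 lbin -> nat_at m 3 i.+1 -> nat_at m 7 0 -> nat_at m 8 1 ->
  nat_at m 9 n -> nat_at m 10 L -> nat_at m 11 D -> nat_at m 12 B ->
  nat_at m 18 N -> (forall k : 'I_n, nat_at m (L + k + k) (l k)) ->
  (forall k : 'I_n, nat_at m (L + k + k).+1 (w k)) ->
  wp mk_env m (40 * N * (n * M)) env.
Proof.
move=> h1 h3 h7 h8 h9 h10 h11 h12 h18 hL hW.
have n0 : 0 < n by apply: leq_ltn_trans (ltn_ord i).
have M0 : 0 < M by rewrite expn_gt0.
apply: (@wp_le _ _ (2 + (N * 4 + 2 + (6 + (n * 8 + 2 + (1 + (n * M * 5 + 2)))))));
  last by nia.
apply: wp_seq; blk.
apply: wp_seq; apply: (@wp_while _ _ _ _ _ _ (fun f m' => exists2 c, f + c = N &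
   [/\ agree (fun r => (r != 13) && (r != 22)) m m', nat_at m' 22 c &
       nat_at m' 13 (B ^ c)])).
- move=> f m1 [c fc [ag1 h22 h13]].
  have h18' : nat_at m1 18 N by look.
  rewrite h22 h18' ltr_nat => cN; exists f.-1; first by lia.
  blk; exists c.+1; first by lia.
  by split; [agr | rewrite -[c.+1]addn1; look | rewrite expnSr; look].
- move=> f m1 [c fc [ag1 h22 h13]].
  have h18' : nat_at m1 18 N by look.
  rewrite h22 h18' ltr_nat -leqNgt => Nc.
  have e : c = N by lia.
  rewrite e in h13.
  apply: wp_seq; blk.
  rewrite -WbE -IbE -TbE.
  (* Register 25 is described only for s < n: the last iteration divides by n - n = 0. *)
  apply: wp_seq; apply: (@wp_while _ _ _ _ _ _ (fun f m' => exists2 s, f + s = n &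
    [/\ agree (fun r => [|| r < 14, r == 18 | 32 <= r < D]) m1 m', nat_at m' 20 s,
      (s < n -> m' 25 = weight n s),
      (forall s', s' < s -> m' (Wb + s') = weight n s') &
      [/\ nat_at m' 14 Wb, nat_at m' 15 Ib, nat_at m' 16 Tb & nat_at m' 17 (n * M)]])).
  + move=> f' m2 [s fs [ag2 h20 h25 hs [h14 h15 h16 h17]]].
    have h9' : nat_at m2 9 n by look.
    rewrite h20 h9' ltr_nat => sn; exists f'.-1; first by lia.
    have {} h25 := h25 sn.
    blk; exists s.+1; first by lia.
    split; [agr | by rewrite -[s.+1]addn1; look | | | by split; look].
    * by move=> hlt; rewrite weightS // -[s.+1]addn1; look.
    * move=> s'; rewrite ltnS leq_eqVlt => /predU1P[-> | hlt]; first by look.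
      by have hs' := hs _ hlt; look.
  + move=> f' m2 [s fs [ag2 h20 _ hs [h14 h15 h16 h17]]].
    have h9' : nat_at m2 9 n by look.
    rewrite h20 h9' ltr_nat -leqNgt => ns.
    apply: wp_seq; blk.
    apply: (@wp_while _ _ _ _ _ _ (fun f m' => exists2 x, f + x = n * M &
      [/\ agree (fun r => [|| r < 21, 32 <= r < D | Wb <= r < Ib]) m2 m', nat_at m' 21 x &
        forall y, y < x -> nat_at m' (Ib + y) y])).
    * move=> f0 m3 [x fx [ag3 h21 hid]].
      have h17' : nat_at m3 17 (n * M) by look.
      rewrite h21 h17' ltr_nat => xM; exists f0.-1; first by lia.
      blk; exists x.+1; first by lia.
      split; [agr | by rewrite -[x.+1]addn1; look | move=> y].
      rewrite ltnS leq_eqVlt => /predU1P[-> | hy]; first by look.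
      by have hidy := hid y hy; look.
    * move=> f0 m3 [x fx [ag3 h21 hid]].
      have h17' : nat_at m3 17 (n * M) by look.
      rewrite h21 h17' ltr_nat -leqNgt => Mx.
      have n2 k : k < n -> L + k + k < D - 1 by lia.
      split; try look.
      -- by move=> k; have hk := hL k; have := n2 k (ltn_ord k); move=> ?; look.
      -- by move=> k; have hk := hW k; have := n2 k (ltn_ord k); move=> ?; look.
      -- by move=> s' hs'; have hk := hs s' (leq_trans hs' ns); look.
      -- by move=> y hy; apply: hid; apply: leq_trans Mx.
    * exists 0; first by rewrite addn0.
      by split; [agr | look |].
  + exists 0; first by rewrite addn0.
    split; [agr | look | | by [] | by split; look].
    by move=> _; rewrite weight0 //; look.
- exists 0; first by rewrite addn0.
  by split; [agr | look | look].
Qed.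

End Machine.

(* Every low register may hold input, so registers have to be freed before any
   counter is available. Address 8 n lies beyond the input and serves as a spill
   slot; the item data move up by 8 n + 32. *)
Definition relocate_step :=
  Block [:: IConst 2 32%:R; IAdd 2 2 0; IAdd 2 2 4; ILoad 7 4; IStore 2 7;
            IConst 2 1%:R; IAdd 4 4 2].

(** The label is parked at 8 n, which frees register 2 as an address register for moving registers 3
    to 7 one by one; then n is recovered as 8 n / 8. *)
Definition relocate :=
  Seq (Block [:: IAdd 0 0 0; IAdd 0 0 0; IAdd 0 0 0; IStore 0 2;
    IConst 2 35%:R; IAdd 2 2 0; IStore 2 3; ILoad 3 0;
    IConst 2 36%:R; IAdd 2 2 0; IStore 2 4; IConst 2 37%:R; IAdd 2 2 0; IStore 2 5;
    IConst 2 38%:R; IAdd 2 2 0; IStore 2 6; IConst 2 39%:R; IAdd 2 2 0; IStore 2 7;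
    IConst 6 8%:R; IDiv 6 0 6; IAdd 5 6 6; IConst 2 3%:R; IAdd 5 5 2; IConst 4 8%:R])
  (While 4 5 relocate_step).

Lemma relocate_spec m n lbin i : 0 < n ->
  nat_at m 0 n -> nat_at m 1 lbin -> nat_at m 2 i ->
  wp relocate m (70 * n) (fun m' =>
    [/\ nat_at m' 0 (8 * n), nat_at m' 1 lbin, nat_at m' 3 i, nat_at m' 6 n &
        forall j, 3 <= j < 2 * n + 3 -> m' (8 * n + 32 + j) = m j]).
Proof.
move=> n0 h0 h1 h2.
(* The loop copies addresses 8 to 2 n + 2, none at all when n <= 2. *)
apply: (@wp_le _ _ (26 + ((maxn 8 (2 * n + 3) - 8) * 7.+2 + 2))); last by lia.
apply: wp_seq; apply: wp_block; first by [].
do 3 one.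
have -> : n + n + (n + n) + (n + n + (n + n)) = 8 * n by lia.
(* Values that [look] can assign to these registers. *)
have [m3 m4 m5 m6 m7] : [/\ m 3 = m 3, m 4 = m 4, m 5 = m 5, m 6 = m 6 & m 7 = m 7] by [].
do 19 one.
have -> : ((8 * n)%:R / 8%:R)%R = n%:R%R :> rat.
  by rewrite natrM mulrAC mulfV ?mul1r // pnatr_eq0.
repeat one.
lazymatch goal with |- wp _ ?m0 _ _ =>
  apply: (@wp_while _ _ _ _ _ _ (fun f m' => exists2 j, f + j = maxn 8 (2 * n + 3) &
   [/\ agree (fun r => [|| r < 2, r == 3, r == 5, r == 6 | 8 <= r < 8 * n]) m0 m',
     8 <= j <= maxn 8 (2 * n + 3), nat_at m' 4 j &
     forall j', 3 <= j' < j -> m' (8 * n + 32 + j') = m j']))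
end.
- move=> f m1 [j fj [ag hj h4 hcopy]].
  have h0' : nat_at m1 0 (8 * n) by look.
  have h5' : nat_at m1 5 (n + n + 3) by look.
  rewrite h4 h5' ltr_nat => jn; exists f.-1; first by lia.
  have hmj : m1 j = m j by look.
  have e : 32 + 8 * n + j = 8 * n + 32 + j by lia.
  blk; rewrite e; exists j.+1; first by lia.
  split; [agr | lia | rewrite -[j.+1]addn1; look | move=> j' hj'].
  have [-> | hlt] : j' = j \/ 3 <= j' < j by lia.
    by look.
  by have hc := hcopy _ hlt; look.
- move=> f m1 [j fj [ag hj h4 hcopy]].
  have h5' : nat_at m1 5 (n + n + 3) by look.
  rewrite h4 h5' ltr_nat -leqNgt => nj.
  split; try look.
  by move=> j' hj'; apply: hcopy; lia.
- exists 8; first by lia.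
  split; [by [] | lia | look | move=> j' hj'].
  have : j' \in [:: 3; 4; 5; 6; 7] by rewrite !inE; lia.
  by rewrite !inE => /or4P[/eqP->|/eqP->|/eqP->|/orP[]/eqP->]; look.
Qed.

(* Rounding up by counting: B - 1 grows until (B - 1) l_k >= l_bin w_k for all k. *)
Definition find_base_step :=
  Seq load_item (Seq (Block [:: IMul 24 1 29; ISub 25 12 8; IMul 25 25 28])
    (Seq (While 25 24 (Block [:: IAdd 25 25 28; IAdd 12 12 8])) (Block [:: IAdd 20 20 8]))).

Definition find_base :=
  Seq (Block [:: IConst 7 0%:R; IConst 8 1%:R; IAdd 9 7 6; IConst 10 35%:R; IAdd 10 10 0;
    IAdd 11 9 9; IAdd 11 11 10; IAdd 18 1 8; IConst 12 1%:R; IConst 20 0%:R])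
  (While 20 9 find_base_step).

(** The density bound makes all optimal values digits in base X + 1, and X <= w_max keeps the table
    within the time bound. *)
Lemma find_base_spec m n (l w : 'I_n -> nat) lbin i :
  (forall k, 0 < l k) -> 0 < n ->
  nat_at m 0 (8 * n) -> nat_at m 1 lbin -> nat_at m 3 i -> nat_at m 6 n ->
  (forall k : 'I_n, nat_at m (8 * n + 35 + k + k) (l k)) ->
  (forall k : 'I_n, nat_at m (8 * n + 35 + k + k).+1 (w k)) ->
  wp find_base m (30 * (knap_wmax l w lbin).+1 * n) (fun m' => exists X,
    [/\ X <= knap_wmax l w lbin, forall k, lbin * w k <= X * l k,
        nat_at m' 1 lbin, nat_at m' 3 i &
    [/\ nat_at m' 7 0, nat_at m' 8 1, nat_at m' 9 n,
        nat_at m' 10 (8 * n + 35) & nat_at m' 11 (10 * n + 35)] /\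
    [/\ nat_at m' 12 X.+1, nat_at m' 18 lbin.+1,
        (forall k : 'I_n, nat_at m' (8 * n + 35 + k + k) (l k)) &
        (forall k : 'I_n, nat_at m' (8 * n + 35 + k + k).+1 (w k))]]).
Proof.
move=> hl n0 h0 h1 h3 h6 hL hW; set W := knap_wmax l w lbin.
apply: (@wp_le _ _ (10 + (n * (5 + (3 + (W * 4 + 2 + 1))).+2 + 2))); last by nia.
apply: wp_seq; apply: wp_block; first by [].
do 5 one.
rewrite (addnC 35).
do 2 one.
have -> : n + n + (8 * n + 35) = 10 * n + 35 by lia.
repeat one.
lazymatch goal with |- wp _ ?m0 _ _ =>
  apply: (@wp_while _ _ _ _ _ _ (fun f m' => exists2 k, f + k = n & exists X,
   [/\ agree (fun r => [|| r < 12, r == 18 | 32 <= r]) m0 m', nat_at m' 20 k,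
     nat_at m' 12 X.+1, X <= W & forall j : 'I_n, j < k -> lbin * w j <= X * l j]))
end.
- move=> f m1 [k fk [X [ag h20 h12 XW hX]]].
  have h9 : nat_at m1 9 n by look.
  rewrite h20 h9 ltr_nat => kn; exists f.-1; first by lia.
  pose j := Ordinal kn.
  have hlj : nat_at m1 (8 * n + 35 + k + k) (l j) by have := hL j; move=> ?; look.
  have hwj : nat_at m1 (8 * n + 35 + k + k).+1 (w j) by have := hW j; move=> ?; look.
  have h8 : nat_at m1 8 1 by look.
  have h10 : nat_at m1 10 (8 * n + 35) by look.
  have h1' : nat_at m1 1 lbin by look.
  apply: wp_seq; apply: wp_weaken (load_item_correct h8 h10 h20 hlj hwj _) _ _ => //; first by lia.
  move=> m2 [ag2 h28 h29].
  apply: wp_seq; apply: wp_block; first by [].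
  do 2 one.
  rewrite subn1 /=.
  repeat one.
  apply: wp_seq.
  apply: (@wp_le _ _ ((W - X) * 4 + 2)); first last.
    by rewrite leq_add2r leq_mul2r leq_subr orbT.
  lazymatch goal with |- wp _ ?m0 _ _ =>
  apply: (@wp_while _ _ _ _ _ _ (fun f m' => exists2 Y, f + Y = W &
    [/\ agree (fun r => [|| r < 12, r == 18, r == 20, r == 24, r == 28 | 32 <= r]) m0 m',
      nat_at m' 12 Y.+1, nat_at m' 25 (Y * l j) & X <= Y]))
  end.
  + move=> f' m3 [Y fY [ag3 h12' h25 XY]].
    have h24 : nat_at m3 24 (lbin * w j) by look.
    rewrite h25 h24 ltr_nat => hlt.
    (* While Y l_j < l_bin w_j, the counter is below the ceiling of l_bin w_j / l_j, hence below
       w_max. *)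
    have YW : Y < W.
      rewrite /W /knap_wmax; apply: (bigop.bigmax_sup j) => //.
      rewrite leq_divRL // mulSn; have := hl j; lia.
    exists f'.-1; first by lia.
    blk; exists Y.+1; first by lia.
    split; [agr | rewrite -[Y.+2]addn1; look | rewrite mulSn addnC; look | lia].
  + move=> f' m3 [Y fY [ag3 h12' h25 XY]].
    have h24 : nat_at m3 24 (lbin * w j) by look.
    rewrite h25 h24 ltr_nat -leqNgt => hle.
    blk; exists k.+1; first by lia.
    exists Y; split; [agr | rewrite -[k.+1]addn1; look | look | lia | ].
    move=> j'; rewrite ltnS leq_eqVlt => /predU1P[e | hj'].
      by rewrite (_ : j' = j) //; apply: val_inj.
    by apply: leq_trans (hX _ hj') _; rewrite leq_mul2r XY orbT.
  + exists X; first by lia.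
    by split; [by [] | look | look |].
- move=> f m1 [k fk [X [ag h20 h12 XW hX]]].
  have h9 : nat_at m1 9 n by look.
  rewrite h20 h9 ltr_nat -leqNgt => nk.
  exists X; split; [by [] | | look | look | split; split; try look].
  + by move=> j; apply: hX; apply: leq_trans nk.
  + by rewrite -[lbin.+1]addn1; look.
  + by move=> j; have := hL j => ?; look.
  + by move=> j; have := hW j => ?; look.
- exists 0; first by rewrite addn0.
  by exists 0; split; [by [] | look | look | |].
Qed.

(** * Assembling the program and its running time *)

Lemma knap_input_item n (l w : 'I_n -> nat) lbin i (k : 'I_n) :
  nat_at (knap_input l w lbin i).2 (3 + k + k) (l k) /\
  nat_at (knap_input l w lbin i).2 (3 + k + k).+1 (w k).
Proof.
rewrite /knap_input /=.
have -> : 3 + k + k - 3 = k.*2 by lia.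
have -> : (3 + k + k).+1 - 3 = k.*2.+1 by lia.
by rewrite /= odd_double !divn2 /= uphalf_double doubleK valK add0n oddD addbb.
Qed.

Definition knapsack_shapley := Seq relocate (Seq find_base (Seq mk_env solve)).

(* There is a unit-cost RAM program P and a constant C such that on every
   knapsack budgeted game instance and every agent i, P halts within
   C * l_bin (w_max+1)^(l_bin+1) |N|^2 steps with phi_i(v) in register 0. *)
Theorem theorem2 :
  exists (P : program) (C : nat),
    forall (n : nat) (l w : 'I_n -> nat) (lbin : nat) (i : 'I_n),
      (forall k : 'I_n, 0 < l k <= lbin) ->
      exists (t : nat) (s : mstate),
        t <= C * knap_bound l w lbin /\
        run P t (knap_input l w lbin i) = Some s /\
        s.2 0 = shapley (knapsack_game l w lbin) i.
Proof.
exists (compile 0 knapsack_shapley), 600 => n l w lbin i hl.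
have n0 : 0 < n by apply: leq_ltn_trans (ltn_ord i).
have l0 : 0 < lbin by have /andP[] := hl i; apply: leq_trans.
suff h : wp knapsack_shapley (knap_input l w lbin i).2 (600 * knap_bound l w lbin)
    (fun m' => m' 0 = shapley (knapsack_game l w lbin) i).
  by have [t [s [ht hr hs]]] := wp_run h; exists t, s.
set W := knap_wmax l w lbin.
set M := W.+1 ^ lbin.+1.
(* Since l_bin + 1 <= 2 l_bin, the four phases cost at most 70, 30, 80 and 400 times the bound,
   which the constant 600 covers. *)
apply: (@wp_le _ _ (70 * n + (30 * W.+1 * n +
    (40 * lbin.+1 * (n * M) + 200 * lbin.+1 * M * n ^ 2)))); last first.
  have WM : W.+1 <= M by rewrite /M expnS leq_pmulr // expn_gt0.
  have hb : knap_bound l w lbin = lbin * M * n ^ 2 by [].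
  have N2 : lbin.+1 <= 2 * lbin by lia.
  have M0 : 0 < M by apply: leq_trans WM.
  have U1 : n * M <= M * n ^ 2 by rewrite -mulnn mulnA mulnC leq_mul2r leq_pmulr ?orbT.
  have U2 : n * M <= lbin * M * n ^ 2 by rewrite -mulnA; apply: leq_trans U1 _; apply: leq_pmull.
  have U3 : W.+1 * n <= n * M by rewrite mulnC leq_mul2l WM orbT.
  have U4 : n <= n * M by apply: leq_pmulr.
  have U5 : lbin.+1 * (n * M) <= 2 * lbin * (M * n ^ 2) by apply: leq_mul.
  have U6 : lbin.+1 * (M * n ^ 2) <= 2 * lbin * (M * n ^ 2) by rewrite leq_mul2r N2 orbT.
  rewrite hb; move: U1 U2 U3 U4 U5 U6; rewrite -!mulnA.
  by move: (n ^ 2) => n2; lia.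
apply: wp_seq; apply: wp_weaken (relocate_spec (lbin := lbin) (i := i.+1) n0 _ _ _) _ _ => //.
move=> m1 [h0 h1 h3 h6 hcopy].
have hL (k : 'I_n) : nat_at m1 (8 * n + 35 + k + k) (l k).
  have -> : 8 * n + 35 + k + k = 8 * n + 32 + (3 + k + k) by lia.
  rewrite hcopy; last by have := ltn_ord k; lia.
  by case: (knap_input_item l w lbin i k).
have hW (k : 'I_n) : nat_at m1 (8 * n + 35 + k + k).+1 (w k).
  have -> : (8 * n + 35 + k + k).+1 = 8 * n + 32 + (3 + k + k).+1 by lia.
  rewrite hcopy; last by have := ltn_ord k; lia.
  by case: (knap_input_item l w lbin i k).
have hl0 k : 0 < l k by case/andP: (hl k).
apply: wp_seq; apply: wp_weaken (find_base_spec hl0 n0 h0 h1 h3 h6 hL hW) _ _ => //.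
move=> m2 [X [XW hX g1 g3 [[g7 g8 g9 g10 g11] [g12 g18 gL gW]]]].
have XM : X.+1 ^ lbin.+1 <= M by rewrite leq_exp2r.
apply: wp_seq.
apply: wp_weaken (mk_env_spec erefl erefl erefl erefl erefl
  g1 g3 g7 g8 g9 g10 g11 g12 g18 gL gW) _ _.
  by rewrite !leq_mul2l XM !orbT.
move=> m3 em; apply: wp_le (solve_spec hl erefl erefl erefl erefl erefl hX em) _ => //.
by rewrite leq_mul2r leq_mul2l XM !orbT.
Qed.
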